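(* Let $E,F$ be Banach spaces such that $F$ has cotype $q$, and let $g:E\to F$ be a mapping which is analytic at $a\in E$. Then $g$ is absolutely $(q;1)$-summing at $a$.
   Context: All spaces are Banach spaces over $\mathbb{K}=\mathbb{R}$ or $\mathbb{C}$. For $2\le q\le\infty$, $F$ has cotype $q$ if there is a constant $C_q(F)\ge0$ such that $(\sum_{j=1}^k\|x_j\|^q)^{1/q}\le C_q(F)\big(\int_0^1\|\sum_{j=1}^k r_j(t)x_j\|^2dt\big)^{1/2}$ for all $k$ and $x_1,\dots,x_k\in F$ ($r_j$ the Rademacher functions; the left side is $\max_j\|x_j\|$ if $q=\infty$). $g:E\to F$ is analytic at $a\in E$ if there are a ball $B_\delta(a)$ and continuous $k$-homogeneous polynomials $P_k:E\to F$ such that $g(x)=\sum_{k=0}^\infty P_k(x-a)$ uniformly for $x\in B_\delta(a)$. For $0<p<\infty$, $\|(x_j)\|_{w,p}=\sup_{\varphi\in B_{E'}}(\sum_j|\varphi(x_j)|^p)^{1/p}$, $l_p^w(E)$ is the space of sequences in $E$ for which this is finite, and $l_p^u(E)$ is the subspace of those $(x_j)\in l_p^w(E)$ with $\lim_{m\to\infty}\|(x_j)_{j=m}^\infty\|_{w,p}=0$. $l_p(E)$ is the space of sequences with $\sum_j\|x_j\|^p<\infty$ (bounded sequences if $p=\infty$). A mapping $f:E\to F$ is absolutely $(s;r)$-summing at $a\in E$ if $(f(a+x_j)-f(a))_{j=1}^\infty\in l_s(F)$ whenever $(x_j)_{j=1}^\infty\in l_r^u(E)$. *)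

(* Defs.v *)
From HB Require Import structures.
From mathcomp Require Import all_boot all_order all_algebra.
From mathcomp Require Import complex.
From mathcomp Require Import all_classical all_reals all_analysis.
Import Order.TTheory GRing.Theory Num.Theory.
Import numFieldNormedType.Exports.

Set Implicit Arguments.
Unset Strict Implicit.
Unset Printing Implicit Defensive.

Local Open Scope classical_set_scope.
Local Open Scope ring_scope.

(* Banach spaces over IK = R or C are the [completeNormedModType (scalars R k)],
   for a kind [k] of scalars. *)
Variant scalar_kind := RealScalars | ComplexScalars.

Definition scalars (R : realType) (k : scalar_kind) : numFieldType :=
  match k with
  | RealScalars => R
  | ComplexScalars => R[i]
  end.

Definition of_real (R : realType) (k : scalar_kind) : R -> scalars R k :=
  match k with
  | RealScalars => fun x => x
  | ComplexScalars => fun x => (x%:C)%C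
  end.

Definition real_part (R : realType) (k : scalar_kind) : scalars R k -> R :=
  match k with
  | RealScalars => fun x => x
  | ComplexScalars => fun z => complex.Re z
  end.

(* In the library the norm of a normed space over IK takes its values in IK
   itself, in the nonnegative reals; [rnorm] is the same norm with values
   in [R]. *)
Definition rnorm (R : realType) (k : scalar_kind)
    (V : normedZmodType (scalars R k)) (x : V) : R :=
  real_part `|x|.

Section Polynomials.
Context (K : numFieldType) (E F : normedModType K).

(* [dfwith x u] is the family [x] with its [i]-th entry replaced by [u]. *)
Definition multilinear (n : nat) (A : ('I_n -> E) -> F) : Prop :=
  forall (i : 'I_n) (x : 'I_n -> E),
    linear (fun u : E => A (@dfwith _ (fun=> E) x i u)).

Definition continuous_homogeneous_polynomial (n : nat) (P : E -> F) : Prop :=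
  (exists A : ('I_n -> E) -> F,
      multilinear A /\ forall x, P x = A (fun=> x)) /\
  continuous P.

Definition analytic_at (g : E -> F) (a : E) : Prop :=
  exists (d : K) (P : nat -> E -> F),
    [/\ 0 < d,
        forall n, continuous_homogeneous_polynomial n (P n) &
        {uniform ball a d,
          (fun (N : nat) (x : E) => \sum_(0 <= n < N) P n (x - a)) @ \oo --> g}].

End Polynomials.

(* The j-th Rademacher function, j >= 1. *)
Definition rademacher (R : realType) (j : nat) (t : R) : R :=
  Num.sg (sin (2 ^+ j * pi * t)).

Section Cotype.
Context (R : realType) (k : scalar_kind).

Definition finite_lq_norm (V : normedZmodType (scalars R k)) (q : \bar R)
    (n : nat) (x : 'I_n -> V) : R :=
  match q with
  | r%:E => (\sum_(j < n) rnorm (x j) `^ r) `^ r^-1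
  | +oo%E => \big[Num.max/0]_(j < n) rnorm (x j)
  | -oo%E => 0 (* junk value, never used *)
  end.

(* The index [j : 'I_n] starts at 0, hence the [j.+1]. *)
Definition has_cotype (F : normedModType (scalars R k)) (q : \bar R) : Prop :=
  exists C : R, 0 <= C /\
    forall (n : nat) (x : 'I_n -> F),
      finite_lq_norm q x <=
      C * (\int[lebesgue_measure]_(t in `[0, 1])
             rnorm (\sum_(j < n) of_real k (rademacher j.+1 t) *: x j) ^+ 2)
          `^ 2^-1.

End Cotype.

Section Summing.
Context (R : realType) (k : scalar_kind).
Local Open Scope ereal_scope.

Definition dual_unit_ball (E : normedModType (scalars R k))
    : set {scalar E} :=
  [set phi | forall x : E, (rnorm (phi x) <= rnorm x)%R].

Definition weak_norm (E : normedModType (scalars R k)) (p : R) (x : nat -> E)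
    : \bar R :=
  ereal_sup
    [set (\sum_(0 <= j <oo) (rnorm (phi (x j)) `^ p)%:E) `^ p^-1
    | phi in @dual_unit_ball E].

Definition in_lpw (E : normedModType (scalars R k)) (p : R) (x : nat -> E)
    : Prop :=
  weak_norm p x < +oo.

Definition in_lpu (E : normedModType (scalars R k)) (p : R) (x : nat -> E)
    : Prop :=
  in_lpw p x /\ (fun m => weak_norm p (fun j => x (m + j)%N)) @ \oo --> 0.

Definition in_lp (F : normedModType (scalars R k)) (p : \bar R) (y : nat -> F)
    : Prop :=
  match p with
  | r%:E => \sum_(0 <= j <oo) (rnorm (y j) `^ r)%:E < +oo
  | +oo => exists M : R, forall j, (rnorm (y j) <= M)%R
  | -oo => False (* junk value, never used *)
  end.

Definition absolutely_summing_at (E F : normedModType (scalars R k))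
    (s : \bar R) (r : R) (f : E -> F) (a : E) : Prop :=
  forall x : nat -> E, in_lpu r x -> in_lp s (fun j => f (a + x j)%R - f a)%R.

End Summing.

(* Main.v *)
From HB Require Import structures.
Require Import Defs.
From mathcomp Require Import all_boot all_order all_algebra.
From mathcomp Require Import complex ring.
From mathcomp Require Import all_classical all_reals all_analysis.
Import Order.TTheory GRing.Theory Num.Theory.
Import numFieldNormedType.Exports.

Set Implicit Arguments.
Unset Strict Implicit.
Unset Printing Implicit Defensive.

Local Open Scope classical_set_scope.
Local Open Scope ring_scope.

(** The heart of the matter is an unconditional estimate that involves neither
    cotype nor measure theory: if all combinations [\sum_j c_j x_j] with
    [|c_j| <= 1] have norm at most [r], where [r] is small enough in terms of
    [g] and [a] only, then all combinations [\sum_j e_j (g (a + x_j) - g a)]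
    with [|e_j| <= 1] have norm at most [3] ([analytic_sums_bounded]).  Taking
    for the [e_j] the values of the Rademacher functions, the integral in the
    definition of cotype is at most [9], and a single application of cotype
    bounds the finite q-norms of the vectors [g (a + x_j) - g a] uniformly
    ([cotype_bound]).

    The hypothesis on the combinations of the [x_j] holds for a tail of every
    sequence in [l_1^u(E)]: by Hahn-Banach ([hahn_banach],
    [norming_functional]) the norm of [\sum_j c_j x_j] is attained by a
    functional [phi] of norm at most one, hence is at most
    [\sum_j |phi (x_j)|], that is, at most the weak 1-norm
    ([norm_sum_le_weak_norm]).  The omitted head is finite, so it does not
    affect membership in [l_q(F)] ([in_lp_tail]).

    The unconditional estimate is proved one homogeneous term at a time.  Write
    [P x = A (x, ..., x)] with [A] n-linear.  Averaging over independent signs,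
    [x_j = E (d_j S_d)] with [S_d = \sum_i d_i x_i]; replacing the arguments of
    [A] one slot after the other in this way bounds [\sum_j e_j P x_j] by the
    supremum of [A] over arguments taken among the combinations of the [x_j]
    ([decoupling]).  The symmetrized [A] is in turn controlled by [P] through
    the polarization formula ([polarization]), at the cost of a factor
    [n^n / n! <= 4^n].  Uniform convergence of the Taylor series makes the
    [P_n] bounded by a common constant on a fixed ball
    ([analytic_terms_bounded]); by homogeneity the n-th term contributes at
    most [2 (8 r / rho)^n], and these bounds sum up when [r = rho / 16]. *)

(** * The Hahn-Banach theorem *)

Section HahnBanach.
Context (R : realType) (E : lmodType R).

Definition sublinear (p : E -> R) : Prop :=
  (forall x y, p (x + y) <= p x + p y) /\
  (forall t x, 0 <= t -> p (t *: x) = t * p x).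

Lemma sublinear0 p : sublinear p -> p 0 = 0.
Proof. by case=> _ /(_ 0 0 (lexx 0)); rewrite scale0r mul0r. Qed.

Lemma sublinear_oppN p x : sublinear p -> - p (- x) <= p x.
Proof.
by move=> hp; rewrite lerNl -subr_ge0 opprK -(sublinear0 hp) -(addNr x) hp.1.
Qed.

(** Both infima used below, over a half-line and over a chain, are instances of
    this criterion; the index realizing each inequality may vary. *)
Lemma inf_sublinear (I : Type) (A : set I) (q : I -> E -> R) :
    A !=set0 -> (forall x, has_lbound [set q i x | i in A]) ->
    (forall i j x y, A i -> A j ->
      exists2 k, A k & q k (x + y) <= q i x + q j y) ->
    (forall i t x, A i -> 0 <= t ->
      exists2 k, A k & q k (t *: x) <= t * q i x) ->
  sublinear (fun x => inf [set q i x | i in A]).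
Proof.
move=> [i0 Ai0] lbq subq homq; set p := fun x => _.
have p_le i x : A i -> p x <= q i x by move=> Ai; apply: ge_inf => //; exists i.
have le_p m x : (forall i, A i -> m <= q i x) -> m <= p x.
  move=> mq; apply: lb_le_inf; first by exists (q i0 x), i0.
  by move=> _ [i Ai <-]; exact: mq.
have hom_le t x : 0 < t -> p (t *: x) <= t * p x.
  move=> t0; rewrite mulrC -ler_pdivrMr//; apply/le_p => i Ai.
  have [k Ak qk] := homq i t x Ai (ltW t0).
  by rewrite ler_pdivrMr// mulrC; apply: le_trans qk; exact: p_le.
have subp x y : p (x + y) <= p x + p y.
  rewrite -lerBlDr; apply/le_p => i Ai; rewrite lerBlDl -lerBlDr.
  apply/le_p => j Aj; rewrite lerBlDr [leRHS]addrC.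
  by have [k Ak] := subq i j x y Ai Aj; apply: le_trans; exact: p_le.
have p0 : p 0 = 0.
  apply/eqP; rewrite eq_le; apply/andP; split.
    have [k Ak] := homq i0 0 0 Ai0 (lexx 0).
    by rewrite scale0r mul0r; apply: le_trans; exact: p_le.
  by have := subp 0 0; rewrite addr0 -lerBlDr subrr.
split=> // t x; rewrite le_eqVlt => /predU1P[<-|t0].
  by rewrite scale0r mul0r.
apply/eqP; rewrite eq_le hom_le//= mulrC -ler_pdivlMr// mulrC.
have := hom_le t^-1 (t *: x).
by rewrite invr_gt0 scalerA mulVf ?gt_eqF// scale1r; exact.
Qed.

(** For [p] sublinear this is the largest sublinear [q <= p] with
    [q (- y) <= - p y]: it lowers [p] just enough to become linear along the
    line spanned by [y]. *)
Definition slide (p : E -> R) (y x : E) : R :=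
  inf [set p (x + t *: y) - t * p y | t in [set t : R | 0 <= t]].

Lemma slide_lbound p y x : sublinear p ->
  has_lbound [set p (x + t *: y) - t * p y | t in [set t : R | 0 <= t]].
Proof.
move=> [subp homp]; exists (- p (- x)) => _ [t /= t0 <-].
rewrite -homp// lerBrDr addrC lerBlDr.
by apply: le_trans (subp _ _); rewrite addrAC subrr add0r.
Qed.

Lemma slide_le p y x t : sublinear p -> 0 <= t ->
  slide p y x <= p (x + t *: y) - t * p y.
Proof. by move=> hp t0; apply: ge_inf; [exact: slide_lbound|exists t]. Qed.

Lemma slide_sublinear p y : sublinear p -> sublinear (slide p y).
Proof.
move=> hp; have [subp homp] := hp.
apply: (@inf_sublinear R [set t | 0 <= t]
  (fun t x => p (x + t *: y) - t * p y)).
- by exists 0 => /=.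
- by move=> x; exact: slide_lbound.
- move=> s t u v /= s0 t0; exists (s + t); first exact: addr_ge0.
  by rewrite addrACA -opprD -mulrDl lerD2r scalerDl addrACA subp.
- move=> s t u /= s0 t0; exists (t * s); first exact: mulr_ge0.
  by rewrite -scalerA -scalerDr homp// mulrBr mulrA.
Qed.

(** Zorn's lemma for the reverse pointwise order.  The infimum of a chain stays
    finite because a sublinear [q <= p] satisfies [- p (- x) <= q x]. *)
Lemma minimal_sublinear p : sublinear p ->
  exists q, [/\ sublinear q, forall x, q x <= p x &
    forall r, sublinear r -> (forall x, r x <= q x) -> r = q].
Proof.
move=> hp; pose T := {q : E -> R | sublinear q /\ forall x, q x <= p x}.
pose mkT r (hr : sublinear r) (rp : forall x, r x <= p x) : T :=
  exist _ r (conj hr rp).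
pose above (q r : T) := `[< forall x, sval r x <= sval q x >].
have [||||[q [hq qp]] qmin] := @Zorn T above.
- by move=> q; exact/asboolP.
- move=> q r s /asboolP qr /asboolP rs; apply/asboolP => x.
  exact: le_trans (rs x) (qr x).
- move=> [q hq] [r hr] /asboolP /= qr /asboolP /= rq.
  have qrE : q = r by apply/funext => x; apply/eqP; rewrite eq_le rq qr.
  by subst r; congr exist; exact: Prop_irrelevance.
- move=> A totA; case: (pselect (A !=set0)) => [A0|/set0P/negP/negbNE/eqP ->].
    pose q (r : T) x := sval r x.
    have lbA x : has_lbound [set q r x | r in A].
      exists (- p (- x)) => _ [r Ar <-].
      apply: le_trans (sublinear_oppN x (svalP r).1).
      by rewrite lerN2; exact: (svalP r).2.
    have infA : sublinear (fun x => inf [set q r x | r in A]).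
      apply: inf_sublinear => //.
        move=> r s x y Ar As.
        have [/asboolP rs|/asboolP sr] := totA r s Ar As.
          exists s => //; apply: le_trans ((svalP s).1.1 _ _) _.
          by rewrite lerD2r.
        exists r => //; apply: le_trans ((svalP r).1.1 _ _) _.
        by rewrite lerD2l.
      by move=> r t x Ar t0; exists r => //; rewrite /q (svalP r).1.2.
    have infp x : inf [set q r x | r in A] <= p x.
      have [r Ar] := A0; apply: le_trans ((svalP r).2 x).
      by apply: ge_inf => //; exists r.
    exists (mkT _ infA infp) => r Ar; apply/asboolP => x /=.
    by apply: ge_inf => //; exists r.
  by exists (mkT _ hp (fun x => lexx (p x))).
exists q; split=> // r hr rq.
have rp x : r x <= p x by exact: le_trans (rq x) (qp x).
have /qmin/(congr1 sval) : above (mkT q hq qp) (mkT r hr rp) by exact/asboolP.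
by [].
Qed.

(** A minimal sublinear [q] is additive: [slide q y] is sublinear and below [q],
    hence equal to [q], which says that [q x <= q (x + y) - q y].  Minimizing
    below [slide p x0] instead of [p] forces the value at [x0]. *)
Lemma hahn_banach p (x0 : E) : sublinear p ->
  exists u : {scalar E}, (forall x, u x <= p x) /\ u x0 = p x0.
Proof.
move=> hp; have hp0 := slide_sublinear x0 hp.
have [q [hq qp qmin]] := minimal_sublinear hp0.
have qD x y : q (x + y) = q x + q y.
  have slideq : slide q y = q.
    apply: qmin; first exact: slide_sublinear.
    move=> z; have := slide_le y z hq (lexx 0).
    by rewrite scale0r addr0 mul0r subr0.
  apply/eqP; rewrite eq_le hq.1 /= -lerBrDr -{1}slideq.
  by have := slide_le y x hq ler01; rewrite scale1r mul1r.
have qN x : q (- x) = - q x.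
  by apply/eqP; rewrite -addr_eq0 -qD addNr sublinear0.
have qZ : scalar q.
  move=> t x y; rewrite qD; congr (_ + _).
  have [t0|t0] := leP 0 t; first exact: hq.2.
  rewrite -[t in LHS]opprK scaleNr qN hq.2 ?oppr_ge0 ?ltW//.
  by rewrite mulNr opprK.
pose u : {scalar E} := HB.pack q (GRing.isLinear.Build _ _ _ _ _ qZ).
have qlep x : q x <= p x.
  apply: le_trans (qp x) _.
  by have := slide_le x0 x hp (lexx 0); rewrite scale0r addr0 mul0r subr0.
exists u; split=> //=; apply/eqP; rewrite eq_le qlep /=.
rewrite -lerN2 -qN; apply: le_trans (qp _) _.
have := slide_le x0 (- x0) hp ler01.
by rewrite scale1r addNr mul1r sublinear0// sub0r.
Qed.

End HahnBanach.

(** * Real and complex scalars *)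

Section Scalars.
Context (R : realType) (k : scalar_kind).
Implicit Types (s t : R) (V : normedZmodType (scalars R k)).

Lemma of_realD s t : of_real k (s + t) = of_real k s + of_real k t.
Proof. by case: k => //=; rewrite rmorphD. Qed.

Lemma of_realM s t : of_real k (s * t) = of_real k s * of_real k t.
Proof. by case: k => //=; rewrite rmorphM. Qed.

Lemma of_real0 : of_real k (0 : R) = 0.
Proof. by case: k. Qed.

Lemma of_real1 : of_real k (1 : R) = 1.
Proof. by case: k. Qed.

Lemma ler_of_real s t : (of_real k s <= of_real k t) = (s <= t).
Proof. by case: k => //=; rewrite lecR. Qed.

Lemma ltr_of_real s t : (of_real k s < of_real k t) = (s < t).
Proof. by case: k => //=; rewrite ltcR. Qed.

Lemma norm_of_real s : `|of_real k s| = of_real k `|s|.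
Proof. by case: k => //=; rewrite normc_def/= expr0n/= addr0 sqrtr_sqr. Qed.

Lemma of_real_real_part (z : scalars R k) :
  0 <= z -> of_real k (real_part z) = z.
Proof.
by move: z; case: k => //= -[a b]; rewrite lecE/= => /andP[/eqP -> _].
Qed.

Lemma of_realK : cancel (@of_real R k) (@real_part R k).
Proof. by case: k. Qed.

Lemma of_real_rnorm V (x : V) : of_real k (rnorm x) = `|x|.
Proof. exact: of_real_real_part. Qed.

Lemma rnorm_ge0 V (x : V) : 0 <= rnorm x.
Proof. by rewrite -ler_of_real of_real_rnorm of_real0. Qed.

Lemma ler_rnorm V (x : V) s : (rnorm x <= s) = (`|x| <= of_real k s).
Proof. by rewrite -ler_of_real of_real_rnorm. Qed.

Lemma rnormD V (x y : V) : rnorm (x + y) <= rnorm x + rnorm y.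
Proof. by rewrite ler_rnorm of_realD !of_real_rnorm ler_normD. Qed.

Lemma rnormN V (x : V) : rnorm (- x) = rnorm x.
Proof. by rewrite /rnorm normrN. Qed.

Lemma rnorm_sum V (I : Type) (r : seq I) (x : I -> V) :
  rnorm (\sum_(i <- r) x i) <= \sum_(i <- r) rnorm (x i).
Proof.
elim/big_ind2: _ => // [|x1 x2 y1 y2 h1 h2].
  by rewrite ler_rnorm normr0 of_real0.
by apply: le_trans (rnormD _ _) _; exact: lerD.
Qed.

Lemma of_real_inj : injective (@of_real R k).
Proof. exact: can_inj of_realK. Qed.

End Scalars.

(** * Norming functionals *)

(** A copy of the space on which only the real scalars act, so that the real
    Hahn-Banach theorem covers both kinds of scalars. *)
Definition real_restriction (R : realType) (k : scalar_kind)
  (E : lmodType (scalars R k)) : Type := E.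

Section RealRestriction.
Context (R : realType) (k : scalar_kind) (E : lmodType (scalars R k)).

HB.instance Definition _ := GRing.Zmodule.on (real_restriction E).

Let scale_real (t : R) (x : real_restriction E) : real_restriction E :=
  of_real k t *: (x : E).

Let scale_realA s t x : scale_real s (scale_real t x) = scale_real (s * t) x.
Proof. by rewrite /scale_real scalerA of_realM. Qed.

Let scale_real1 : left_id 1 scale_real.
Proof. by move=> x; rewrite /scale_real of_real1 scale1r. Qed.

Let scale_realDr : right_distributive scale_real +%R.
Proof. by move=> t x y; rewrite /scale_real scalerDr. Qed.

Let scale_realDl x : {morph scale_real^~ x : s t / s + t}.
Proof. by move=> s t; rewrite /scale_real of_realD scalerDl. Qed.

HB.instance Definition _ :=
  GRing.Zmodule_isLmodule.Build R (real_restriction E) scale_realA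
    scale_real1 scale_realDr scale_realDl.

End RealRestriction.

Section NormingFunctional.
Context (R : realType) (k : scalar_kind).

Lemma rnorm_sublinear (E : normedModType (scalars R k)) :
  @sublinear R (real_restriction E) (@rnorm R k E).
Proof.
split=> [x y|t x t0]; first exact: rnormD.
apply: (@of_real_inj R k); rewrite of_realM !of_real_rnorm.
by rewrite [LHS](@normrZ _ E) norm_of_real ger0_norm.
Qed.

(** Over the complex numbers [phi x = u x - i u (i x)] is linear with real part
    [u]; its modulus at [x] is the value of [u] at a unimodular multiple of
    [x], so passing from [u] to [phi] does not increase the norm. *)
Lemma real_linear_dominated (E : normedModType (scalars R k))
    (u : {scalar (real_restriction E)}) :
  (forall x, u x <= rnorm (x : E)) ->
  exists phi : {scalar E},
    dual_unit_ball phi /\ forall x : E, u x <= rnorm (phi x).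
Proof.
case: k E u => E u ule.
  have linu : scalar (u : E -> R) by move=> t x y; rewrite linearP.
  pose phi : {scalar E} :=
    HB.pack (u : E -> R) (GRing.isLinear.Build _ _ _ _ _ linu).
  exists phi; split=> x; last exact: ler_norm.
  rewrite /rnorm /= ler_norml ule andbT lerNl -linearN.
  by apply: le_trans (ule _) _; rewrite rnormN.
pose f (x : E) : R[i] := (u x -i* u ('i%C *: x))%C.
have uD (x y : E) : u (x + y) = u x + u y := linearD u x y.
have uZ (t : R) (x : E) : u (t%:C%C *: x) = t * u x .
  exact: (linearZ_LR u t x).
have scaleE (z : R[i]) (x : E) : z *: x =
    (complex.Re z)%:C%C *: x + (complex.Im z)%:C%C *: ('i%C *: x).
  by rewrite scalerA -scalerDl mulrC -complexE.
have linf : scalar f.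
  move=> z x y; rewrite /f scalerDr !uD scalerA mulrC -scalerA.
  rewrite !(scaleE z) !uD !uZ scalerA -expr2 sqr_i scaleN1r.
  rewrite -scaleN1r -[-1](rmorphN1 (real_complex R)) uZ mulN1r mulrN.
  case: z => a b /=; simpc; apply/eqP; rewrite eq_complex /=.
  by apply/andP; split; apply/eqP => //; rewrite (addrC (- _)).
pose phi : {scalar E} := HB.pack f (GRing.isLinear.Build _ _ _ _ _ linf).
exists phi; split=> x; rewrite (_ : phi x = f x)//; last first.
  have := normc_ge_Re (f x); rewrite lecE => /andP[_].
  by apply: le_trans; exact: ler_norm.
have [fx0|fx0] := eqVneq (f x) 0.
  rewrite fx0 /rnorm normr0; exact: (rnorm_ge0 x).
(* The unimodular scalar that rotates [f x] to its modulus. *)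
pose c := `|f x| / f x.
have c1 : `|c| = 1 by rewrite normrM normr_id normfV divff// normr_eq0.
change (complex.Re `|f x| <= rnorm x).
suff -> : complex.Re `|f x| = u (c *: x).
  apply: le_trans (ule _) _.
  by rewrite /rnorm normrZ c1 mul1r.
have : f (c *: x) = `|f x|.
  by rewrite [LHS](linearZ_LR phi c x) /= -mulrA mulVf// mulr1.
by move=> <-.
Qed.

Lemma norming_functional (E : normedModType (scalars R k)) (x : E) :
  exists2 phi : {scalar E}, dual_unit_ball phi & rnorm x <= rnorm (phi x).
Proof.
have [u [ule ux]] :=
  @hahn_banach R (real_restriction E) _ x (rnorm_sublinear E).
have [phi [phi1 uphi]] := real_linear_dominated ule.
by exists phi => //; rewrite -ux.
Qed.

End NormingFunctional.

(** * Averages over signs *)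

Section SignAverages.
Context (I : finType).
Implicit Types (d : {ffun I -> bool}) (K : numFieldType).

Definition flip (i : I) (d : {ffun I -> bool}) : {ffun I -> bool} :=
  [ffun j => d j (+) (j == i)].

Lemma flipK i : involutive (flip i).
Proof. by move=> d; apply/ffunP => j; rewrite !ffunE addbK. Qed.

(** Cancellation in pairs: the engine of all sign averages below. *)
Lemma sum_flip_eq0 K (i : I) (f : {ffun I -> bool} -> K) :
  (forall d, f (flip i d) = - f d) -> \sum_d f d = 0.
Proof.
move=> fN; apply/eqP; rewrite -[_ == 0](mulrn_eq0 _ 2) mulr2n.
rewrite [X in X + _](reindex_inj (inv_inj (flipK i))) /=.
by under eq_bigr do rewrite fN; rewrite sumrN addNr.
Qed.

Lemma sign_flip K i d j :
  (-1) ^+ flip i d j = (-1) ^+ (j == i) * (-1) ^+ d j :> K.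
Proof. by rewrite ffunE signr_addb mulrC. Qed.

Lemma sum_sign_mul K (i j : I) :
  \sum_(d : {ffun I -> bool}) (-1) ^+ d i * (-1) ^+ d j =
    (i == j)%:R * (2 ^ #|I|)%:R :> K.
Proof.
case: eqVneq => [<-|ij]; last first.
  rewrite mul0r; apply: (@sum_flip_eq0 _ i) => d.
  by rewrite !sign_flip eqxx eq_sym (negbTE ij) mul1r !mulN1r mulNr.
under eq_bigr do rewrite -expr2 sqrr_sign.
by rewrite mul1r sumr_const card_ffun card_bool.
Qed.

(** If [phi] is not injective it misses some [i], and flipping the i-th sign
    changes the sign of the first product only. *)
Lemma sum_sign_prod K (phi : {ffun I -> I}) :
  \sum_(d : {ffun I -> bool})
      (\prod_i (-1) ^+ d i) * (\prod_i (-1) ^+ d (phi i)) =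
    (injectiveb phi)%:R * (2 ^ #|I|)%:R :> K.
Proof.
have [/injectiveP phi_inj|phi_ninj] := boolP (injectiveb phi).
  under eq_bigr => d _.
    rewrite [X in X * _](reindex_inj phi_inj) /= -expr2 -prodrXl.
    by rewrite big1 => [|i _]; rewrite ?sqrr_sign//; over.
  by rewrite mul1r sumr_const card_ffun card_bool.
have /subsetPn[i _ nphi] : ~~ (predT \subset codom phi).
  apply: contra phi_ninj => /subset_leq_card cphi; apply/injectiveP => i j.
  apply: (@image_injP _ _ phi predT _) => //.
  by rewrite eqn_leq leq_image_card cphi.
rewrite mul0r; apply: (@sum_flip_eq0 _ i) => d.
rewrite [X in X * _](bigD1 i) //= sign_flip eqxx mulN1r !mulNr; congr (- _).
rewrite [in RHS](bigD1 i) //=; congr (_ * _ * _); apply: eq_bigr => j ji.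
  by rewrite sign_flip (negbTE ji) mul1r.
rewrite sign_flip (_ : phi j == i = false) ?mul1r//.
by apply: contraNF nphi => /eqP <-; exact: codom_f.
Qed.

End SignAverages.

(** * Expansion of multilinear maps *)

Section Multilinear.
Context (K : numFieldType) (E F : normedModType K).

(** Splitting off the first argument, for inductions on the number of slots. *)
Definition fcons n (u : E) (y : 'I_n -> E) (i : 'I_n.+1) : E :=
  if unlift ord0 i is Some j then y j else u.

Lemma fcons0 n u (y : 'I_n -> E) : fcons u y ord0 = u.
Proof. by rewrite /fcons unlift_none. Qed.

Lemma fconsS n u (y : 'I_n -> E) j : fcons u y (lift ord0 j) = y j.
Proof. by rewrite /fcons liftK. Qed.

Lemma fcons_eta n (y : 'I_n.+1 -> E) :
  y = fcons (y ord0) (fun j => y (lift ord0 j)).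
Proof.
apply/funext => i.
by case: (unliftP ord0 i) => [j|] ->; rewrite ?fcons0 ?fconsS.
Qed.

Lemma dfwith_fcons0 n u (y : 'I_n -> E) v :
  @dfwith _ (fun=> E) (fcons u y) ord0 v = fcons v y.
Proof.
apply/funext => i; case: (unliftP ord0 i) => [j|] ->.
  by rewrite dfwithout ?fconsS// neq_lift.
by rewrite dfwithin fcons0.
Qed.

Lemma dfwith_fconsS n u (y : 'I_n -> E) j v :
  @dfwith _ (fun=> E) (fcons u y) (lift ord0 j) v =
  fcons u (@dfwith _ (fun=> E) y j v).
Proof.
apply/funext => i; case: (unliftP ord0 i) => [l|] ->.
  rewrite fconsS; case: (eqVneq j l) => [->|jl]; first by rewrite !dfwithin.
  by rewrite !dfwithout ?fconsS// (inj_eq lift_inj).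
by rewrite dfwithout ?fcons0.
Qed.

Lemma multilinear_fcons n (A : ('I_n.+1 -> E) -> F) u :
  multilinear A -> multilinear (fun y => A (fcons u y)).
Proof.
move=> mA i x c v w; have := mA (lift ord0 i) (fcons u x) c v w.
by rewrite !dfwith_fconsS.
Qed.

Lemma multilinear_head n (A : ('I_n.+1 -> E) -> F) (y : 'I_n -> E) :
  multilinear A -> linear (fun u => A (fcons u y)).
Proof.
move=> mA c v w; have := mA ord0 (fcons 0 y) c v w.
by rewrite !dfwith_fcons0.
Qed.

Lemma linear_sumZ (L : E -> F) (I : Type) (r : seq I) (c : I -> K)
    (v : I -> E) :
  linear L -> L (\sum_(i <- r) c i *: v i) = \sum_(i <- r) c i *: L (v i).
Proof.
move=> linL.
pose L' : {linear E -> F} := HB.pack L (GRing.isLinear.Build _ _ _ _ _ linL).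
rewrite [LHS](raddf_sum L'); apply: eq_bigr => i _.
exact: (linearZ_LR L').
Qed.

Lemma multilinearZ n (A : ('I_n -> E) -> F) (c : K) (x : 'I_n -> E) :
  multilinear A -> A (fun i => c *: x i) = c ^+ n *: A x.
Proof.
elim: n A x => [|n IHn] A x mA.
  by rewrite scale1r; congr A; apply/funext; case.
rewrite [X in A X]fcons_eta [X in A X]/= (IHn (fun y => A (fcons _ y)));
  last exact: multilinear_fcons.
have := linear_sumZ [:: tt] (fun=> c) (fun=> x ord0)
  (multilinear_head (fun j => x (lift ord0 j)) mA).
by rewrite !big_seq1 => ->; rewrite scalerA -exprSr -fcons_eta.
Qed.

Lemma multilinear_sumZ n (A : ('I_n -> E) -> F) (I : finType)
    (c : 'I_n -> I -> K) (v : I -> E) : multilinear A ->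
  A (fun k => \sum_i c k i *: v i) =
  \sum_(phi : {ffun 'I_n -> I}) (\prod_k c k (phi k)) *: A (fun k => v (phi k)).
Proof.
elim: n A c => [|n IHn] A c mA.
  pose phi0 : {ffun 'I_0 -> I} :=
    [ffun j : 'I_0 => False_rect I (notF (ltn_ord j))].
  rewrite (big_pred1 phi0).
    by rewrite big_ord0 scale1r; congr A; apply/funext; case.
  by move=> phi /=; apply/esym/eqP/ffunP; case.
rewrite [X in A X]fcons_eta /= (linear_sumZ _ _ _ (multilinear_head _ mA)).
under [LHS]eq_bigr => i _.
  rewrite (IHn (fun y => A (fcons (v i) y)) (fun k => c (lift ord0 k)));
    last exact: multilinear_fcons.
  rewrite scaler_sumr; over.
rewrite pair_big /=.
pose f (p : I * {ffun 'I_n -> I}) : {ffun 'I_n.+1 -> I} :=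
  [ffun k => if unlift ord0 k is Some j then p.2 j else p.1].
pose g (phi : {ffun 'I_n.+1 -> I}) :=
  (phi ord0, [ffun j : 'I_n => phi (lift ord0 j)]).
rewrite (reindex f) /=; last first.
  exists g => [[i phi]|phi] _.
    congr pair; rewrite /= ?ffunE ?unlift_none//.
    by apply/ffunP => j; rewrite !ffunE liftK.
  apply/ffunP => k; rewrite ffunE; case: unliftP => [j|] -> //=.
  by rewrite ffunE.
apply: eq_bigr => -[i phi] _ /=; rewrite scalerA big_ord_recl ffunE unlift_none.
congr (_ * _ *: A _).
  by apply: eq_bigr => j _; rewrite ffunE liftK.
by apply/funext => k; rewrite ffunE /fcons; case: unliftP.
Qed.

End Multilinear.

(** * Decoupling and polarization *)

Lemma bin_leq_exp2 n m : ('C(n, m) <= 2 ^ n)%N.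
Proof.
rewrite -{1}(card_ord n) -card_draws -[X in (2 ^ X)%N](card_ord n) -cardsT.
by rewrite -card_powerset powersetT cardsT max_card.
Qed.

(** [n^n] is at most the falling factorial [2n (2n - 1) ... (n + 1)], which is
    [n!] times a binomial coefficient [<= 2^(2n)]. *)
Lemma exp_leq_fact n : (n ^ n <= 4 ^ n * n`!)%N.
Proof.
apply: (@leq_trans ('C(n + n, n) * n`!)%N); last first.
  rewrite leq_mul2r (leq_trans (bin_leq_exp2 _ _)) ?orbT//.
  by rewrite addnn -mul2n expnM.
rewrite bin_ffact ffact_prod -[X in (_ ^ X)%N]card_ord -prod_nat_const.
by apply: leq_prod => i _; rewrite -addnBA ?leq_addr// ltnW.
Qed.

Section PolynomialBounds.
Context (K : numFieldType) (E F : normedModType K).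

Lemma sum_signs_const n (M : K) :
  (2 ^ n)%:R * M = \sum_(d : {ffun 'I_n -> bool}) M.
Proof. by rewrite sumr_const card_ffun card_bool card_ord mulr_natl. Qed.

(** Induction on the number of slots.  For independent signs [d] one has
    [x_j = E (d_j S_d)] with [S_d = \sum_i d_i x_i], so that the sum is the
    average over [d] of the sums [\sum_j e_j d_j A (S_d, x_j, ..., x_j)], in
    which the first argument no longer depends on [j].  The last slot absorbs
    the sum over [j] by linearity; this is why there must be at least one. *)
Lemma decoupling n (A : ('I_n.+1 -> E) -> F) m (x : 'I_m -> E) (M : K) :
    multilinear A ->
    (forall y, (forall i, exists2 c : 'I_m -> K, forall j, `|c j| <= 1 &
      y i = \sum_j c j *: x j) -> `|A y| <= M) ->
  forall e : 'I_m -> K, (forall j, `|e j| <= 1) ->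
  `|\sum_j e j *: A (fun=> x j)| <= M.
Proof.
elim: n A => [|n IHn] A mA AM e e1.
  under eq_bigr do rewrite [X in A X]fcons_eta.
  have fc0 j : (fun i : 'I_0 => x j) = (fun i : 'I_0 => 0 : E).
    by apply/funext; case.
  under eq_bigr do rewrite fc0.
  rewrite -(linear_sumZ _ _ _ (multilinear_head _ mA)).
  apply: AM => i; exists e => //.
  by rewrite (ord1 i) fcons0.
pose S (d : {ffun 'I_m -> bool}) : E := \sum_i (-1) ^+ d i *: x i.
have avg : (2 ^ m)%:R *: (\sum_j e j *: A (fun=> x j)) =
    \sum_(d : {ffun 'I_m -> bool})
      \sum_j (e j * (-1) ^+ d j) *: A (fcons (S d) (fun=> x j)).
  rewrite exchange_big scaler_sumr /=; apply: eq_bigr => j _.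
  under [RHS]eq_bigr => d _.
    rewrite (linear_sumZ _ _ _ (multilinear_head _ mA)) -scalerA scaler_sumr.
    under eq_bigr do rewrite scalerA.
    over.
  rewrite -scaler_sumr exchange_big /=.
  under [in RHS]eq_bigr do rewrite -scaler_suml sum_sign_mul card_ord.
  rewrite (bigD1 j) //= eqxx mul1r big1 ?addr0; last first.
    by move=> i; rewrite eq_sym => /negbTE ->; rewrite mul0r scale0r.
  rewrite scalerA mulrC -scalerA; congr (_ *: (_ *: A _)).
  by rewrite [LHS]fcons_eta.
have pow0 : 0 < (2 ^ m)%:R :> K by rewrite ltr0n expn_gt0.
rewrite -(ler_pM2l pow0) -[X in X * `|_|]gtr0_norm// -normrZ avg.
apply: le_trans (ler_norm_sum _ _ _) _.
rewrite sum_signs_const; apply: ler_sum => d _.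
apply: (IHn (fun y => A (fcons (S d) y))).
- exact: multilinear_fcons.
- move=> y hy; apply: AM => i; case: (unliftP ord0 i) => [j|] ->.
    by rewrite fconsS.
  rewrite fcons0; exists (fun j => (-1) ^+ d j) => // j.
  by rewrite normrX normrN1 expr1n.
- by move=> j; rewrite normrM normrX normrN1 expr1n mulr1.
Qed.

(** The sum over all permutations, encoded as injective maps because the
    expansion of a multilinear map ranges over arbitrary maps. *)
Definition symmetrization n (A : ('I_n -> E) -> F) (y : 'I_n -> E) : F :=
  \sum_(phi : {ffun 'I_n -> 'I_n} | injectiveb phi) A (fun k => y (phi k)).

Lemma multilinear_symmetrization n (A : ('I_n -> E) -> F) :
  multilinear A -> multilinear (symmetrization A).
Proof.
move=> mA i x c v w; rewrite /symmetrization scaler_sumr -big_split /=.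
apply: eq_bigr => phi /injectiveP phi_inj.
have dfwithE u : (fun k => @dfwith _ (fun=> E) x i u (phi k)) =
    @dfwith _ (fun=> E) (fun k => x (phi k)) (invF phi_inj i) u.
  apply/funext => k; case: (eqVneq (invF phi_inj i) k) => [<-|ik].
    by rewrite f_invF !dfwithin.
  rewrite !dfwithout//; apply: contraNneq ik => ->.
  by rewrite invF_f.
by rewrite !dfwithE mA.
Qed.

Lemma symmetrization_diag n (A : ('I_n -> E) -> F) x :
  symmetrization A (fun=> x) = n`!%:R *: A (fun=> x).
Proof.
rewrite /symmetrization sumr_const scaler_nat -ffactnn.
rewrite -[X in (X ^_ _)%N]card_ord -[X in (_ ^_ X)%N]card_ord.
by rewrite -card_inj_ffuns cardsE.
Qed.

(** Expanding the right-hand side gives one term for each map [phi] of the set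
    of slots into itself, and [sum_sign_prod] selects the permutations. *)
Lemma polarization n (A : ('I_n -> E) -> F) (y : 'I_n -> E) : multilinear A ->
  (2 ^ n)%:R *: symmetrization A y =
  \sum_(d : {ffun 'I_n -> bool})
    (\prod_i (-1) ^+ d i) *: A (fun=> \sum_i (-1) ^+ d i *: y i).
Proof.
move=> mA; under [RHS]eq_bigr => d _.
  rewrite (multilinear_sumZ (fun=> fun i => (-1) ^+ d i))// scaler_sumr.
  over.
rewrite exchange_big /= /symmetrization scaler_sumr big_mkcond /=.
apply: eq_bigr => phi _; under [RHS]eq_bigr do rewrite scalerA.
rewrite -scaler_suml sum_sign_prod card_ord.
by case: ifP => _; rewrite ?mul1r// mul0r scale0r.
Qed.

Lemma symmetrization_bound n (A : ('I_n -> E) -> F) (r M : K) :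
    multilinear A -> (forall z, `|z| <= n%:R * r -> `|A (fun=> z)| <= M) ->
  forall y, (forall i, `|y i| <= r) -> `|symmetrization A y| <= M.
Proof.
move=> mA AM y yr.
have pow0 : 0 < (2 ^ n)%:R :> K by rewrite ltr0n expn_gt0.
rewrite -(ler_pM2l pow0) -[X in X * `|_|]gtr0_norm// -normrZ polarization//.
apply: le_trans (ler_norm_sum _ _ _) _.
rewrite sum_signs_const; apply: ler_sum => d _.
rewrite normrZ normr_prod big1 ?mul1r; last first.
  by move=> i _; rewrite normrX normrN1 expr1n.
apply: AM; apply: le_trans (ler_norm_sum _ _ _) _.
rewrite -[n in n%:R]card_ord mulr_natl -sumr_const; apply: ler_sum => i _.
by rewrite normrZ normrX normrN1 expr1n mul1r.
Qed.

(** Polarization evaluates [A] on the diagonal at points of norm at most [n r];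
    rescaling these into the ball of radius [rho] costs [(2 n r / rho)^n], the
    factor [2] turning a weak inequality into a strict one, and the
    symmetrization contributes [1 / n!]. *)
Lemma sum_homogeneous_bound n (A : ('I_n -> E) -> F) m (x : 'I_m -> E)
    (r rho M : K) :
    (0 < n)%N -> multilinear A -> 0 < r -> 0 < rho ->
    (forall z, `|z| < rho -> `|A (fun=> z)| <= M) ->
    (forall c : 'I_m -> K, (forall j, `|c j| <= 1) ->
       `|\sum_j c j *: x j| <= r) ->
  forall e : 'I_m -> K, (forall j, `|e j| <= 1) ->
  `|\sum_j e j *: A (fun=> x j)| <= M * (8 * r / rho) ^+ n.
Proof.
move=> n0 mA r0 rho0 AM xr e e1.
pose t := 2 * (n%:R * r) / rho.
have nr0 : 0 < n%:R * r by rewrite mulr_gt0// ltr0n.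
have t0 : 0 < t by rewrite divr_gt0// mulr_gt0.
have M0 : 0 <= M by apply: le_trans (AM 0 _); rewrite ?normr0.
have At z : `|z| <= n%:R * r -> `|A (fun=> z)| <= t ^+ n * M.
  move=> zr; have -> : (fun=> z) = (fun=> t *: (t^-1 *: z)) :> ('I_n -> E).
    by apply/funext => i; rewrite scalerA divff ?gt_eqF// scale1r.
  rewrite (multilinearZ t (fun=> t^-1 *: z) mA) normrZ normrX (gtr0_norm t0).
  rewrite ler_pM2l ?exprn_gt0//; apply: AM.
  rewrite normrZ gtr0_norm ?invr_gt0// mulrC ltr_pdivrMr//.
  rewrite /t mulrCA divff ?gt_eqF// mulr1; apply: le_lt_trans zr _.
  by rewrite ltr_pMl// ltr1n.
have : `|\sum_j e j *: symmetrization A (fun=> x j)| <= t ^+ n * M.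
  case: n n0 A mA AM nr0 @t t0 At => // n _ A mA AM nr0 t t0 At.
  apply: decoupling e1; first exact: multilinear_symmetrization.
  move=> y hy; apply: (symmetrization_bound mA At) => i.
  by have [c c1 ->] := hy i; exact: xr.
under eq_bigr do rewrite symmetrization_diag scalerA mulrC -scalerA.
rewrite -scaler_sumr normrZ normr_nat => h.
have f0 : 0 < n`!%:R :> K by rewrite ltr0n fact_gt0.
rewrite -(ler_pM2l f0); apply: (le_trans h).
rewrite [leRHS]mulrCA [leRHS]mulrC; apply: ler_wpM2r => //.
pose s := 2 * r / rho.
have s0 : 0 <= s by rewrite divr_ge0 ?mulr_ge0// ltW.
have -> : t = n%:R * s by rewrite /t /s mulrCA -!mulrA.
have -> : 8 * r / rho = 4 * s :> K by rewrite /s !mulrA -natrM.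
clearbody s; rewrite !exprMn [leRHS]mulrA.
apply: ler_wpM2r; first exact: exprn_ge0.
by rewrite -!natrX -natrM ler_nat mulnC exp_leq_fact.
Qed.

End PolynomialBounds.

(** * Analytic maps *)

Section AnalyticBound.
Context (K : numFieldType) (E F : normedModType K).

Lemma uniform_cvg_dist (A : set E) (f : nat -> E -> F) (g : E -> F) (e : K) :
  {uniform A, f @ \oo --> g} -> 0 < e ->
  exists N0, forall N, (N0 <= N)%N -> forall x, A x -> `|g x - f N x| < e.
Proof.
move=> fg e0; pose U := [set h : E -> F | forall x, A x -> `|g x - h x| < e].
have nbhsU : nbhs (g : {uniform` A -> F}) U.
  apply/uniform_nbhs; exists [set xy : F * F | ball xy.1 e xy.2].
  split; first exact: (entourage_ball _ (PosNum e0)).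
  by move=> h /= hh x Ax; have := hh x Ax; rewrite -ball_normE.
have [N0 _ N0P] := fg _ nbhsU.
by exists N0 => N N0N; exact: N0P.
Qed.

Lemma homogeneous_polynomial0 n (P : E -> F) :
  continuous_homogeneous_polynomial n P -> (0 < n)%N -> P 0 = 0.
Proof.
move=> [[A [mA PA]] _] n0; rewrite PA.
rewrite (_ : (fun=> 0) = (fun=> 0 *: 0)) ?(multilinearZ 0 (fun=> 0) mA).
  by rewrite expr0n gtn_eqF// scale0r.
by apply/funext => i; rewrite scale0r.
Qed.

(** All but finitely many terms are bounded on the whole ball of convergence,
    being differences of consecutive partial sums; continuity at [0] handles
    the others after shrinking the ball. *)
Lemma analytic_terms_bounded (P : nat -> E -> F) (a : E) (d : K) (g : E -> F) :
    0 < d -> (forall n, continuous_homogeneous_polynomial n (P n)) ->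
    {uniform ball a d,
      (fun N x => \sum_(0 <= n < N) P n (x - a)) @ \oo --> g} ->
  exists2 rho : K, 0 < rho & forall z, `|z| < rho ->
    `|z| < d /\ forall n, (0 < n)%N -> `|P n z| <= 2.
Proof.
move=> d0 polyP cvgP; have [N0 N0P] := uniform_cvg_dist cvgP ltr01.
have large n z : (N0 <= n)%N -> `|z| < d -> `|P n z| <= 2.
  move=> N0n zd; have az : ball a d (a + z).
    by rewrite -ball_normE /ball_ /= opprD addNKr normrN.
  have := N0P _ (leqW N0n) _ az; have := N0P _ N0n _ az.
  rewrite big_nat_recr//= [a + z - a]addrAC subrr add0r.
  set S := \sum_(_ <= _ < _) _; move=> h1 h2.
  have -> : P n z = (g (a + z) - S) - (g (a + z) - (S + P n z)).
    by rewrite opprB [RHS]addrC addrA subrK addrAC subrr add0r.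
  by apply: le_trans (ler_normB _ _) _; rewrite -[2]/(1 + 1) lerD ?ltW.
have small N : \forall z \near (0 : E),
    forall n, (0 < n)%N -> (n < N)%N -> `|P n z| <= 2.
  elim: N => [|N IHN]; first by apply: nearW.
  have : \forall z \near (0 : E), (0 < N)%N -> `|P N z| <= 2.
    case: (posnP N) => [->|N0']; first exact: nearW.
    have PN0 : P N z @[z --> 0] --> 0.
      rewrite -[X in _ --> X](homogeneous_polynomial0 (polyP N) N0').
      exact: (polyP N).2.
    move/cvgr0_norm_lt/(_ _ (ltr0Sn K 1)): PN0.
    by apply: filterS => z /ltW.
  move: IHN; apply: filterS2 => z zN PN n + nN1; move: nN1.
  by rewrite ltnS leq_eqVlt => /predU1P[->|nN n0]; [exact: PN|exact: zN].
have : \forall z \near (0 : E), `|z| < d /\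
    forall n, (0 < n)%N -> (n < N0)%N -> `|P n z| <= 2.
  apply: filterS2 (nbhsx_ballx (0 : E) d d0) (small N0) => z.
  by rewrite -ball_normE /ball_ /= sub0r normrN.
move=> /nbhs_ballP[rho /= rho0 rhoP]; exists rho => // z zrho.
have [|zd zP] := rhoP z; first by rewrite -ball_normE /ball_ /= sub0r normrN.
split=> // n n0; case: (leqP N0 n) => [|nN0]; last exact: zP.
by move=> N0n; exact: large.
Qed.

Lemma sum_half_powers_le N : \sum_(1 <= n < N) 2 * 2^-1 ^+ n <= 2 :> K.
Proof.
case: N => [|N]; first by rewrite big_geq.
suff -> : \sum_(1 <= n < N.+1) 2 * 2^-1 ^+ n = 2 - 2 * 2^-1 ^+ N :> K.
  by rewrite gerBl mulr_ge0// exprn_ge0// invr_ge0.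
elim: N => [|N IHN]; first by rewrite big_geq// expr0 mulr1 subrr.
rewrite big_nat_recr//= IHN -addrA; congr (_ + _).
by rewrite exprS; field.
Qed.

(** With [r = rho / 16] the n-th term of the series contributes at most
    [2 / 2^n], hence the terms of index at least one contribute at most [2]
    together; a partial sum close enough to [g] at the [m] points [a + x_j] and
    at [a] leaves an error of at most [1]. *)
Lemma analytic_sums_bounded (g : E -> F) (a : E) : analytic_at g a ->
  exists2 r : K, 0 < r & forall m (x : 'I_m -> E),
    (forall c : 'I_m -> K, (forall j, `|c j| <= 1) ->
       `|\sum_j c j *: x j| <= r) ->
    forall e : 'I_m -> K, (forall j, `|e j| <= 1) ->
    `|\sum_j e j *: (g (a + x j) - g a)| <= 3.
Proof.
move=> [d [P [d0 polyP cvgP]]].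
have [rho rho0 rhoP] := analytic_terms_bounded d0 polyP cvgP.
exists (rho / 16); first by rewrite divr_gt0.
move=> m x xr e e1.
have xd j : `|x j| < d.
  apply: (rhoP _ _).1; apply: (@le_lt_trans _ _ (rho / 16)).
    (* A single [x j] is itself a combination of the family. *)
    have := xr (fun i => (i == j)%:R).
    rewrite (bigD1 j) //= eqxx scale1r big1 ?addr0; last first.
      by move=> i /negbTE ->; rewrite scale0r.
    by apply=> i; case: (_ == _); rewrite ?normr1 ?normr0.
  by rewrite ltr_pdivrMr// ltr_pMr// ltr1n.
pose eta : K := (2 * m.+1%:R)^-1.
have eta0 : 0 < eta by rewrite invr_gt0 mulr_gt0.
have [N0 N0P] := uniform_cvg_dist cvgP eta0.
pose N := maxn 1 N0; pose T y := \sum_(1 <= n < N) P n y.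
have termE y : `|y| < d -> `|(g (a + y) - g a) - T y| <= 2 * eta.
  move=> yd.
  have dist z : `|z| < d -> `|g (a + z) - (P 0 0 + T z)| <= eta.
    move=> zd; have az : ball a d (a + z).
      by rewrite -ball_normE /ball_ /= opprD addNKr normrN.
    have := N0P N (leq_maxr _ _) _ az.
    rewrite big_ltn ?leq_maxl// [a + z - a]addrAC subrr add0r.
    have [A [_ PA]] := (polyP 0%N).1.
    rewrite (_ : P 0%N z = P 0%N 0) => [/ltW//|].
    by rewrite !PA; congr A; apply/funext; case.
  have T0 : T 0 = 0.
    rewrite /T big_nat big1// => n /andP[n0 _].
    exact: homogeneous_polynomial0.
  (* The constant term: [g a] is only known here up to [eta]. *)
  have := dist 0; rewrite normr0 T0 !addr0 => /(_ d0) h0.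
  have -> : g (a + y) - g a - T y =
      (g (a + y) - (P 0%N 0 + T y)) - (g a - P 0%N 0).
    rewrite [in RHS]opprB [in RHS]opprD [X in _ = X + _]addrA.
    by rewrite [X in _ = X + _]addrAC [RHS]addrA subrK addrAC.
  apply: le_trans (ler_normB _ _) _.
  by rewrite mulr_natl mulr2n lerD// dist.
have Tbound : `|\sum_j e j *: T (x j)| <= 2.
  under eq_bigr do rewrite scaler_sumr.
  rewrite exchange_big /=; apply: le_trans (ler_norm_sum _ _ _) _.
  apply: le_trans (sum_half_powers_le N); rewrite !big_nat.
  apply: ler_sum => n /andP[n0 _].
  have [A [mA PA]] := (polyP n).1.
  under eq_bigr do rewrite PA.
  have -> : 2^-1 = 8 * (rho / 16) / rho :> K.
    by field; rewrite gt_eqF.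
  apply: sum_homogeneous_bound => //; first by rewrite divr_gt0.
  by move=> z zrho; rewrite -PA; apply: (rhoP z zrho).2.
have -> : \sum_j e j *: (g (a + x j) - g a) =
    \sum_j e j *: T (x j) + \sum_j e j *: ((g (a + x j) - g a) - T (x j)).
  by rewrite -big_split /=; apply: eq_bigr => j _; rewrite -scalerDr subrKC.
apply: le_trans (ler_normD _ _) _; rewrite (natrD _ 2 1) lerD//.
apply: le_trans (ler_norm_sum _ _ _) _.
apply: (@le_trans _ _ (\sum_(j < m) 2 * eta)).
  apply: ler_sum => j _; rewrite normrZ -[leRHS]mul1r.
  by apply: ler_pM => //; exact: termE.
rewrite sumr_const card_ord -[leLHS]mulr_natl.
rewrite /eta invfM (mulrA 2) divff// mul1r.
by rewrite ler_pdivrMr// mul1r ler_nat.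
Qed.

End AnalyticBound.

(** * Weak norms, cotype and summability *)

(** The integral of a nonnegative function is a supremum over the simple
    functions below it, so it is monotone without any measurability; this
    spares the measurability of norms of Rademacher sums. *)
Lemma le_integral_ge0 d (T : measurableType d) (R : realType)
    (mu : {measure set T -> \bar R}) (D : set T) (f1 f2 : T -> \bar R) :
  (forall x, D x -> 0 <= f1 x)%E -> (forall x, D x -> f1 x <= f2 x)%E ->
  (\int[mu]_(x in D) f1 x <= \int[mu]_(x in D) f2 x)%E.
Proof.
move=> f10 f12; have f20 x : D x -> (0 <= f2 x)%E.
  by move=> Dx; exact: le_trans (f10 x Dx) (f12 x Dx).
rewrite !ge0_integralE//; apply: le_ereal_sup => _ [h /= hf <-].
by exists h => //= x; apply: le_trans (hf x) _; exact: lee_restrict.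
Qed.

Section WeakNorm.
Context (R : realType) (k : scalar_kind).

Lemma norm_sum_le_weak_norm (E : normedModType (scalars R k)) (x : nat -> E)
    (s : R) :
  (weak_norm 1 x <= s%:E)%E ->
  forall m (c : 'I_m -> scalars R k), (forall j, `|c j| <= 1) ->
    `|\sum_j c j *: x j| <= of_real k s.
Proof.
move=> xs m c c1; set S := \sum_j _.
have [phi phi1 Sphi] := norming_functional S.
rewrite -ler_rnorm; apply: le_trans Sphi _.
have {1}-> : phi S = \sum_j c j * phi (x j).
  by rewrite linear_sum; apply: eq_bigr => j _; rewrite linearZ_LR.
apply: le_trans (rnorm_sum _ _) _.
apply: (@le_trans _ _ (\sum_(j < m) rnorm (phi (x j)))).
  apply: ler_sum => j _; rewrite -(@ler_of_real R k) !of_real_rnorm normrM.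
  by rewrite ler_piMl.
have pos j : (0 <= (rnorm (phi (x j)) `^ 1)%:E)%E by rewrite lee_fin powR_ge0.
rewrite -lee_fin -sumEFin; apply: le_trans xs.
apply: (@le_trans _ _ (\sum_(0 <= j <oo) (rnorm (phi (x j)) `^ 1)%:E)%E).
  apply: le_trans (nneseries_lim_ge m (fun j _ _ => pos j)).
  by rewrite big_mkord; apply: lee_sum => j _; rewrite powRr1// rnorm_ge0.
apply: ereal_sup_ubound; exists phi => //.
by rewrite invr1 poweRe1//; apply: nneseries_ge0 => j _ _; exact: pos.
Qed.

Lemma of_real_nat n : of_real k n%:R = n%:R :> scalars R k.
Proof. by case: k => //=; rewrite rmorph_nat. Qed.

Lemma norm_rademacher_le1 j (t : R) : `|of_real k (rademacher j t)| <= 1.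
Proof.
rewrite norm_of_real -of_real1 ler_of_real normr_sg.
by case: (_ != 0).
Qed.

(** The signs are allowed to vary in the unit disc, which includes the value [0]
    that the Rademacher functions take at dyadic points. *)
Lemma cotype_bound (F : normedModType (scalars R k)) (q : \bar R) (B : R) :
  has_cotype F q -> 0 <= B ->
  exists C : R, 0 <= C /\ forall m (y : 'I_m -> F),
    (forall e : 'I_m -> scalars R k, (forall j, `|e j| <= 1) ->
       `|\sum_j e j *: y j| <= of_real k B) ->
    finite_lq_norm q y <= C.
Proof.
move=> [C [C0 hC]] B0; exists (C * B); split; first exact: mulr_ge0.
move=> m y yB; apply: le_trans (hC m y) _; apply: ler_wpM2l => //.
have nonneg (t : R) :
    0 <= rnorm (\sum_(j < m) of_real k (rademacher j.+1 t) *: y j) ^+ 2.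
  by rewrite exprn_ge0 ?rnorm_ge0.
set I := Rintegral _ _ _.
have I0 : 0 <= I by exact: Rintegral_ge0.
suff IB : I <= B ^+ 2.
  rewrite powR12_sqrt// -[leRHS]ger0_norm// -sqrtr_sqr ler_sqrt//.
  exact: exprn_ge0.
have mu01 : lebesgue_measure (`[0, 1] : set R) = 1%E.
  by rewrite lebesgue_measure_itv/= lte_fin ltr01 sube0.
have Ile : (\int[lebesgue_measure]_(t in `[0%R : R, 1%R])
    (rnorm (\sum_(j < m) of_real k (rademacher j.+1 t) *: y j) ^+ 2)%:E
      <= (B ^+ 2)%:E)%E.
  rewrite -[leRHS]mule1 -mu01 -integral_cst//; apply: le_integral_ge0 => t _.
    by rewrite lee_fin.
  rewrite lee_fin lerXn2r ?nnegrE ?rnorm_ge0// ler_rnorm.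
  by apply: yB => j; exact: norm_rademacher_le1.
rewrite -lee_fin fineK// ge0_fin_numE ?(le_lt_trans Ile) ?ltry//.
by apply: integral_ge0 => t _; rewrite lee_fin.
Qed.

(** For finite [q] the terms are summed from the uniform bound on the finite
    norms; for [q = +oo] the bound on single terms is enough. *)
Lemma in_lp_tail (F : normedModType (scalars R k)) (q : \bar R) (y : nat -> F)
    (m0 : nat) (B C : R) :
  (2%:E <= q)%E ->
  (forall j, rnorm (y (m0 + j)%N) <= B) ->
  0 <= C -> (forall m, finite_lq_norm q (fun j : 'I_m => y (m0 + j)%N) <= C) ->
  in_lp q y.
Proof.
case: q => [s| |]//= s2 yB C0 yC; last first.
  exists (B + \sum_(j < m0) rnorm (y j)) => j.
  have [m0j|jm0] := leqP m0 j.
    rewrite -(subnKC m0j); apply: le_trans (yB _) _.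
    by rewrite lerDl sumr_ge0// => i _; exact: rnorm_ge0.
  rewrite (bigD1 (Ordinal jm0)) //= addrCA lerDl addr_ge0 ?sumr_ge0//.
    by apply: le_trans (yB 0%N); exact: rnorm_ge0.
  by move=> i _; exact: rnorm_ge0.
have s0 : 0 < s by move: s2; rewrite lee_fin; exact: lt_le_trans.
have pos j : (0 <= (rnorm (y j) `^ s)%:E)%E by rewrite lee_fin powR_ge0.
rewrite (@nneseries_split _ _ 0 m0)// add0n lte_add_pinfty//.
  by rewrite sumEFin ltry.
rewrite -nneseries_addn//.
apply: (@le_lt_trans _ _ (C `^ s)%:E); last by rewrite ltry.
apply: lime_le; first by apply: is_cvg_nneseries.
apply: nearW => m; rewrite sumEFin big_mkord lee_fin.
set X := \sum_(_ < _) _.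
have X0 : 0 <= X by apply: sumr_ge0 => j _; rewrite powR_ge0.
rewrite -[X]powRr1// -(@mulVf _ s) ?gt_eqF// powRrM.
apply: ge0_ler_powR; rewrite ?nnegrE ?powR_ge0 ?(ltW s0)//.
by apply: le_trans (yC m); rewrite /X; under eq_bigr do rewrite addnC.
Qed.

End WeakNorm.

Theorem proposition7 (R : realType) (k : scalar_kind)
    (E F : completeNormedModType (scalars R k)) (q : \bar R)
    (hq : (2%:E <= q)%E) (hF : has_cotype F q)
    (g : E -> F) (a : E) (hg : analytic_at g a) :
  absolutely_summing_at q 1%R g a.
Proof.
move=> x [_ xtail].
have [r r0 gr] := analytic_sums_bounded hg.
have rE : of_real k (real_part r) = r by apply: of_real_real_part; exact: ltW.
have [m0 xm0] : exists m0,
    (weak_norm 1 (fun j => x (m0 + j)%N) < (real_part r)%:E)%E.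
  have : nbhs (0%E : \bar R) [set w | w < (real_part r)%:E]%E.
    apply: open_nbhs_nbhs; split; first exact: open_ereal_lt_ereal.
    by rewrite /= lte_fin -(@ltr_of_real R k) rE of_real0.
  by move=> /xtail[N _ /(_ N (leqnn N))]; exists N.
pose y j := g (a + x j) - g a.
have sums m (e : 'I_m -> scalars R k) : (forall j, `|e j| <= 1) ->
    `|\sum_j e j *: y (m0 + j)%N| <= of_real k 3.
  move=> e1; rewrite of_real_nat; apply: gr e1 => c c1.
  by rewrite -rE; exact: (norm_sum_le_weak_norm (ltW xm0)).
have [C [C0 yC]] := cotype_bound hF (ler0n R 3).
apply: (@in_lp_tail _ _ _ _ y m0 3 C) => // [j|m]; last first.
  by apply: yC => e; exact: sums.
(* The estimate on combinations, for the single coefficient of the last one. *)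
rewrite ler_rnorm; have := @sums j.+1 (fun i => (i == ord_max)%:R).
rewrite (bigD1 ord_max)//= eqxx scale1r big1 ?addr0; last first.
  by move=> i /negbTE ->; rewrite scale0r.
by apply=> i; case: (_ == _); rewrite ?normr1 ?normr0.
Qed.
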